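(* Consider the 2-user broadcast channel over $\mathbb F_3$ with inputs $X_1,X_2\in\mathbb F_3$, in which at each channel use a coefficient $G$ uniform on $\mathbb F_3^\times=\{1,-1\}$ is drawn, independent of the inputs and i.i.d. across channel uses, Rx-1 observes $\overline Y_1=X_1$ and Rx-2 observes $\overline Y_2=(GX_1+X_2,\,G)$. This channel is semi-deterministic, and its sum-capacities with and without NS-assistance are $$C_\Sigma^{\mathrm{NS}}=2\log_2 3,\qquad C_\Sigma=1.5\log_2 3,$$ so that $C_\Sigma^{\mathrm{NS}}/C_\Sigma=4/3$.
   Context: Coding framework: messages $W_1,W_2$ independent and uniform on finite sets $\mathcal M_1,\mathcal M_2$, the transmitter controls $(X_1,X_2)$. Classical scheme: stochastic encoder from messages to the $n$ input symbols and stochastic decoders $\hat W_k=\psi_k(\overline Y_k^{[n]})$. A $\kappa$-partite NS box is a conditional pmf of outputs given inputs (finite output alphabets) such that for every subset of parties the marginal of their outputs depends only on their inputs. NS-assisted scheme: a 3-partite NS box where the transmitter inputs $(W_1,W_2)$ and obtains the channel input sequence as output, and Rx-$k$ inputs $\overline Y_k^{[n]}$ and obtains $\hat W_k$; the joint law is the box distribution times the channel law times $1/(|\mathcal M_1||\mathcal M_2|)$. Rate pairs are achievable if there is a sequence of schemes with vanishing $\max_k\Pr(\hat W_k\ne W_k)$ and $\lim_n\frac1n\log_2|\mathcal M_k^{(n)}|\ge R_k$; capacity region = closure; sum-capacity = max of $R_1+R_2$. *)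

(* Defs.v *)
From HB Require Import structures.
From mathcomp Require Import all_boot all_order all_algebra.
From mathcomp Require Import all_classical all_reals all_analysis.

Set Implicit Arguments.
Unset Strict Implicit.
Unset Printing Implicit Defensive.

Import Order.TTheory GRing.Theory Num.Theory.
Import numFieldNormedType.Exports.
Local Open Scope ring_scope.
Local Open Scope classical_set_scope.

Definition log2 {R : realType} (x : R) : R := ln x / ln 2.

Definition is_cpmf {R : realType} {A B : finType} (K : A -> B -> R) : Prop :=
  (forall a b, 0 <= K a b) /\ (forall a, \sum_(b : B) K a b = 1).

Definition chan_n {R : realType} {X Y1 Y2 : finType} (W : X -> Y1 * Y2 -> R)
  (n : nat) (x : {ffun 'I_n -> X}) (y1 : {ffun 'I_n -> Y1})
  (y2 : {ffun 'I_n -> Y2}) : R :=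
  \prod_(i < n) W (x i) (y1 i, y2 i).

(* A joint law of (W1,W2), X^n, Y1^n, Y2^n, What1, What2. *)
Definition joint_law (R : realType) (X Y1 Y2 : finType) (n m1 m2 : nat) :=
  'I_m1 * 'I_m2 -> {ffun 'I_n -> X} -> {ffun 'I_n -> Y1} -> {ffun 'I_n -> Y2}
  -> 'I_m1 -> 'I_m2 -> R.

Definition err1 {R : realType} {X Y1 Y2 : finType} {n m1 m2 : nat}
  (P : joint_law R X Y1 Y2 n m1 m2) : R :=
  \sum_(w : 'I_m1 * 'I_m2) \sum_(x : {ffun 'I_n -> X})
  \sum_(y1 : {ffun 'I_n -> Y1}) \sum_(y2 : {ffun 'I_n -> Y2})
  \sum_(d1 : 'I_m1 | d1 != w.1) \sum_(d2 : 'I_m2) P w x y1 y2 d1 d2.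

Definition err2 {R : realType} {X Y1 Y2 : finType} {n m1 m2 : nat}
  (P : joint_law R X Y1 Y2 n m1 m2) : R :=
  \sum_(w : 'I_m1 * 'I_m2) \sum_(x : {ffun 'I_n -> X})
  \sum_(y1 : {ffun 'I_n -> Y1}) \sum_(y2 : {ffun 'I_n -> Y2})
  \sum_(d1 : 'I_m1) \sum_(d2 : 'I_m2 | d2 != w.2) P w x y1 y2 d1 d2.

Definition classical_law {R : realType} {X Y1 Y2 : finType}
  (W : X -> Y1 * Y2 -> R) (n m1 m2 : nat)
  (E : 'I_m1 * 'I_m2 -> {ffun 'I_n -> X} -> R)
  (D1 : {ffun 'I_n -> Y1} -> 'I_m1 -> R)
  (D2 : {ffun 'I_n -> Y2} -> 'I_m2 -> R) : joint_law R X Y1 Y2 n m1 m2 :=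
  fun w x y1 y2 d1 d2 =>
    (m1 * m2)%:R^-1 * E w x * chan_n W x y1 y2 * D1 y1 d1 * D2 y2 d2.

Definition classical_scheme {R : realType} {X Y1 Y2 : finType}
  (W : X -> Y1 * Y2 -> R) (n m1 m2 : nat) (e1 e2 : R) : Prop :=
  exists (E : 'I_m1 * 'I_m2 -> {ffun 'I_n -> X} -> R)
    (D1 : {ffun 'I_n -> Y1} -> 'I_m1 -> R)
    (D2 : {ffun 'I_n -> Y2} -> 'I_m2 -> R), [/\ is_cpmf E, is_cpmf D1, is_cpmf D2,
    err1 (classical_law W E D1 D2) = e1 &
    err2 (classical_law W E D1 D2) = e2].

(* A 3-partite non-signaling box: P a b1 b2 o o1 o2 is the probability of
   outputs (o, o1, o2) given inputs (a, b1, b2) of parties (T, 1, 2).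
   For every subset of parties, the marginal of their outputs depends only
   on their inputs. *)
Definition ns_box {R : realType} {A B1 B2 O O1 O2 : finType}
  (P : A -> B1 -> B2 -> O -> O1 -> O2 -> R) : Prop :=
  [/\ (forall a b1 b2 o o1 o2, 0 <= P a b1 b2 o o1 o2),
      (forall a b1 b2, \sum_(o : O) \sum_(o1 : O1) \sum_(o2 : O2)
                          P a b1 b2 o o1 o2 = 1),
  [/\
      (forall a b1 b2 b2' o o1,
         \sum_(o2 : O2) P a b1 b2 o o1 o2 = \sum_(o2 : O2) P a b1 b2' o o1 o2),
      (forall a b1 b1' b2 o o2,
         \sum_(o1 : O1) P a b1 b2 o o1 o2 = \sum_(o1 : O1) P a b1' b2 o o1 o2) &
      (forall a a' b1 b2 o1 o2,
         \sum_(o : O) P a b1 b2 o o1 o2 = \sum_(o : O) P a' b1 b2 o o1 o2)] &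
  [/\
      (forall a b1 b2 b1' b2' o,
         \sum_(o1 : O1) \sum_(o2 : O2) P a b1 b2 o o1 o2
         = \sum_(o1 : O1) \sum_(o2 : O2) P a b1' b2' o o1 o2),
      (forall a a' b1 b2 b2' o1,
         \sum_(o : O) \sum_(o2 : O2) P a b1 b2 o o1 o2
         = \sum_(o : O) \sum_(o2 : O2) P a' b1 b2' o o1 o2) &
      (forall a a' b1 b1' b2 o2,
         \sum_(o : O) \sum_(o1 : O1) P a b1 b2 o o1 o2
         = \sum_(o : O) \sum_(o1 : O1) P a' b1' b2 o o1 o2)]].

(* NS-assisted joint law: box distribution times channel law times
   1/(|M1||M2|). Tx inputs (W1,W2), outputs X^n; Rx-k inputs Y_k^n,
   outputs What_k. *)
Definition ns_law {R : realType} {X Y1 Y2 : finType}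
  (W : X -> Y1 * Y2 -> R) (n m1 m2 : nat)
  (P : 'I_m1 * 'I_m2 -> {ffun 'I_n -> Y1} -> {ffun 'I_n -> Y2} ->
       {ffun 'I_n -> X} -> 'I_m1 -> 'I_m2 -> R) : joint_law R X Y1 Y2 n m1 m2 :=
  fun w x y1 y2 d1 d2 =>
    (m1 * m2)%:R^-1 * P w y1 y2 x d1 d2 * chan_n W x y1 y2.

Definition ns_scheme {R : realType} {X Y1 Y2 : finType}
  (W : X -> Y1 * Y2 -> R) (n m1 m2 : nat) (e1 e2 : R) : Prop :=
  exists (P : 'I_m1 * 'I_m2 -> {ffun 'I_n -> Y1} -> {ffun 'I_n -> Y2} ->
       {ffun 'I_n -> X} -> 'I_m1 -> 'I_m2 -> R), [/\ ns_box P, err1 (ns_law W P) = e1 & err2 (ns_law W P) = e2].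

Definition achievable {R : realType}
  (scheme : nat -> nat -> nat -> R -> R -> Prop) (r : R * R) : Prop :=
  exists (m1 m2 : nat -> nat) (e1 e2 : nat -> R),
    [/\ forall n, (0 < m1 n)%N /\ (0 < m2 n)%N,
        forall n, scheme n (m1 n) (m2 n) (e1 n) (e2 n),
        (fun n => Num.max (e1 n) (e2 n)) @ \oo --> (0 : R),
        exists l1, (fun n => log2 (m1 n)%:R / n%:R) @ \oo --> l1 /\ r.1 <= l1 &
        exists l2, (fun n => log2 (m2 n)%:R / n%:R) @ \oo --> l2 /\ r.2 <= l2].

Definition capacity_region {R : realType}
  (scheme : nat -> nat -> nat -> R -> R -> Prop) : set (R * R) :=
  closure [set r | achievable scheme r].

Definition is_sum_capacity {R : realType}
  (scheme : nat -> nat -> nat -> R -> R -> Prop) (c : R) : Prop :=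
  (exists2 r, capacity_region scheme r & r.1 + r.2 = c) /\
  (forall r, capacity_region scheme r -> r.1 + r.2 <= c).

Definition sum_capacity_classical {R : realType} {X Y1 Y2 : finType}
  (W : X -> Y1 * Y2 -> R) (c : R) : Prop :=
  is_sum_capacity (fun n m1 m2 e1 e2 => classical_scheme W n m1 m2 e1 e2) c.

Definition sum_capacity_NS {R : realType} {X Y1 Y2 : finType}
  (W : X -> Y1 * Y2 -> R) (c : R) : Prop :=
  is_sum_capacity (fun n m1 m2 e1 e2 => ns_scheme W n m1 m2 e1 e2) c.

Definition semi_deterministic {R : realType} {X Y1 Y2 : finType}
  (W : X -> Y1 * Y2 -> R) : Prop :=
  (exists f : X -> Y1, forall x y1, \sum_(y2 : Y2) W x (y1, y2) = (y1 == f x)%:R)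
  \/ (exists f : X -> Y2, forall x y2, \sum_(y1 : Y1) W x (y1, y2) = (y2 == f x)%:R).

(* The example channel over F_3: X = (X1, X2), Y1 = X1,
   Y2 = (G X1 + X2, G) with G uniform on {1, -1}. *)
Definition F3 : finFieldType := 'F_3.

Definition ex_chan {R : realType} (x : F3 * F3) (y : F3 * (F3 * F3)) : R :=
  if [&& y.1 == x.1, (y.2.2 == 1) || (y.2.2 == -1) & y.2.1 == y.2.2 * x.1 + x.2]
  then 2^-1 else 0.

(* Main.v *)
(* NS achievability: let the transmitter and Rx-2 share a box which, on inputs
   X1 and G, gives outputs U and V that are individually uniform and satisfy
   U + V = - G X1. Sending X2 = W2 + U, Rx-2 sees G X1 + X2 = W2 - V and recovers
   W2, so both users get log2 3 bits per use without error. Conversely, even with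
   NS assistance Rx-k guesses W_k with probability at most 3^n / m_k.

   Classical achievability: with X2 = C(W2) - X1, Rx-2 reads C(W2) whenever G = 1
   and ignores the uses with G = -1; this is a ternary erasure channel with
   erasure probability 1/2, for which a random code C has rate (log2 3) / 2.

   Classical converse: fix G^n = g. A classical Rx-2 decodes W2 with the same
   average probability under g and under - g, and the two outputs under g and - g
   together determine X1^n, hence W1. So, if A_g(w2) counts the outputs decoded to
   w2, the messages w1 handled correctly with w2 number at most
   A_g(w2) A_{-g}(w2); summing the square roots over w2 gives
   m2 sqrt(m1) <= O(3^n), that is R1 + 2 R2 <= 2 log2 3, while R1 <= log2 3. *)
Require Import Defs.
From HB Require Import structures.
From mathcomp Require Import all_boot all_order all_algebra.
From mathcomp Require Import all_classical all_reals all_analysis.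
From mathcomp Require Import lra ring zify.

Set Implicit Arguments.
Unset Strict Implicit.
Unset Printing Implicit Defensive.

Import Order.TTheory GRing.Theory Num.Theory.
Import numFieldNormedType.Exports.
Local Open Scope ring_scope.

(** * The channel *)

Definition vec n := {ffun 'I_n -> F3}.

Definition in1 n (x : {ffun 'I_n -> F3 * F3}) : vec n := [ffun i => (x i).1].

Definition sgn3 (b : bool) : F3 := if b then 1 else -1.

Definition out2 (b : bool) (x : F3 * F3) : F3 * F3 :=
  (sgn3 b * x.1 + x.2, sgn3 b).

Definition rx2 n (x : {ffun 'I_n -> F3 * F3}) (b : {ffun 'I_n -> bool})
  : {ffun 'I_n -> F3 * F3} := [ffun i => out2 (b i) (x i)].

Lemma card_vec n : #|{: vec n}| = (3 ^ n)%N.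
Proof. by rewrite card_ffun !card_ord. Qed.

Lemma sgn3N b : sgn3 (~~ b) = - sgn3 b.
Proof. by case: b; rewrite /sgn3 /= ?opprK. Qed.

Section Channel.
Variable R : realType.

(** The channel is an even mixture of two deterministic maps, one for each sign. The mixture form is
    what later replaces sums over outputs by sums over sign sequences. *)
Lemma ex_chanE (x : F3 * F3) (y1 : F3) (y2 : F3 * F3) :
  ex_chan x (y1, y2)
  = 2^-1 * \sum_(b : bool) ((y1 == x.1) && (y2 == out2 b x))%:R :> R.
Proof.
rewrite big_bool /= /ex_chan /out2 /=.
case: y2 => y g /=; rewrite !xpair_eqE.
case: (eqVneq y1 x.1) => _ /=; last by rewrite addr0 mulr0.
case: (eqVneq g 1) => [->|g1] /=.
  (* The two signs differ in F_3, so at most one term of the mixture is nonzero. *)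
  have -> : ((1 : F3) == -1) = false by [].
  by rewrite andbT andbF addr0; case: eqP; rewrite ?mulr1 ?mulr0.
rewrite andbF add0r; case: (eqVneq g (-1)) => [->|g2] /=.
  by rewrite andbT; case: eqP; rewrite ?mulr1 ?mulr0.
by rewrite andbF mulr0.
Qed.

Lemma prod_indicator n (p : 'I_n -> bool) :
  \prod_(i < n) (p i)%:R = [forall i, p i]%:R :> R.
Proof.
case: forallP => [h|h]; first by rewrite big1 // => i _; rewrite h.
have [i hi] : exists i, ~~ p i by apply/existsP; rewrite -negb_forall; apply/forallP.
by rewrite (bigD1 i) //= (negPf hi) mul0r.
Qed.

Lemma chan_nE n (x : {ffun 'I_n -> F3 * F3}) y1 y2 :
  chan_n (@ex_chan R) x y1 y2
  = 2^-1 ^+ n * \sum_b ((y1 == in1 x) && (y2 == rx2 x b))%:R.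
Proof.
rewrite /chan_n; under eq_bigr => i _ do rewrite ex_chanE.
rewrite big_split /= prodr_const card_ord bigA_distr_bigA /=.
congr (_ * _); apply: eq_bigr => b _; rewrite prod_indicator; congr (nat_of_bool _)%:R.
apply/forallP/andP => [h|[/eqP-> /eqP->] i]; last by rewrite !ffunE !eqxx.
by split; apply/eqP/ffunP => i; rewrite ffunE; have /andP[/eqP ? /eqP ?] := h i.
Qed.

(** Eliminates the channel outputs: the only channel randomness left is a uniform sign sequence
    [b]. *)
Lemma chan_sum n (x : {ffun 'I_n -> F3 * F3}) (F : _ -> _ -> R) :
  \sum_y1 \sum_y2 chan_n (@ex_chan R) x y1 y2 * F y1 y2
  = 2^-1 ^+ n * \sum_b F (in1 x) (rx2 x b).
Proof.
under eq_bigr => y1 _ do under eq_bigr => y2 _ do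
  rewrite chan_nE -mulrA mulr_suml.
under eq_bigr => y1 _ do rewrite -mulr_sumr.
rewrite -mulr_sumr; congr (_ * _).
under eq_bigr => y1 _ do rewrite exchange_big /=.
rewrite exchange_big /=; apply: eq_bigr => b _.
rewrite (bigD1 (in1 x)) //= [X in _ + X]big1 ?addr0; last first.
  by move=> y1 /negPf h; rewrite big1 // => y2 _; rewrite h mul0r.
rewrite (bigD1 (rx2 x b)) //= [X in _ + X]big1 ?addr0; last first.
  by move=> y2 /negPf h; rewrite h andbF mul0r.
by rewrite !eqxx mul1r.
Qed.

Lemma mean_bool n (c : R) : 2^-1 ^+ n * \sum_(b : {ffun 'I_n -> bool}) c = c.
Proof.
rewrite sumr_const card_ffun card_bool card_ord -[c *+ _]mulr_natl natrX mulrA.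
by rewrite -exprMn mulVf ?expr1n ?mul1r // pnatr_eq0.
Qed.

Lemma ex_chan_cpmf : is_cpmf (@ex_chan R).
Proof.
split=> [x y|x].
  by rewrite /ex_chan; case: ifP => // _; rewrite invr_ge0 ler0n.
rewrite -(pair_big xpredT xpredT (fun y1 y2 => ex_chan x (y1, y2))) /=.
under eq_bigr => y1 _ do under eq_bigr => y2 _ do rewrite ex_chanE.
under eq_bigr => y1 _ do rewrite -mulr_sumr exchange_big /=.
rewrite -mulr_sumr exchange_big /=.
rewrite (eq_bigr (fun _ => 1)); last first.
  move=> b _; rewrite (bigD1 x.1) //= [X in _ + X]big1 ?addr0; last first.
    by move=> y1 /negPf h; rewrite big1 // => y2 _; rewrite h.
  rewrite (bigD1 (out2 b x)) //= [X in _ + X]big1 ?addr0 ?eqxx //.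
  by move=> y2 /negPf h; rewrite h andbF.
by rewrite sumr_const card_bool mulVf // pnatr_eq0.
Qed.

Lemma ex_chan_semi_deterministic : semi_deterministic (@ex_chan R).
Proof.
left; exists fst => x y1.
under eq_bigr => y2 _ do rewrite ex_chanE.
rewrite -mulr_sumr exchange_big /= big_bool /=.
have h b : \sum_(y2 : F3 * F3) ((y1 == x.1) && (y2 == out2 b x))%:R
   = (y1 == x.1)%:R :> R.
  rewrite (bigD1 (out2 b x)) //= [X in _ + X]big1 ?addr0 ?eqxx ?andbT //.
  by move=> y2 /negPf h; rewrite h andbF.
rewrite !h; lra.
Qed.

End Channel.

(** * Bounds for non-signaling boxes *)

Section Schemes.
Variables (R : realType) (n m1 m2 : nat).
Hypotheses (m1_gt0 : (0 < m1)%N) (m2_gt0 : (0 < m2)%N).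

Definition box := 'I_m1 * 'I_m2 -> vec n -> {ffun 'I_n -> F3 * F3} ->
  {ffun 'I_n -> F3 * F3} -> 'I_m1 -> 'I_m2 -> R.

Let sumP2 (p : pred 'I_m1) (q : pred 'I_m2) (F : _ -> _ -> R) (c : R) :
  \sum_(d1 | p d1) \sum_(d2 | q d2) c * F d1 d2
  = c * \sum_(d1 | p d1) \sum_(d2 | q d2) F d1 d2.
Proof. by rewrite mulr_sumr; apply: eq_bigr => d1 _; rewrite mulr_sumr. Qed.

(** The predicates [p] and [q] make both error events instances of one formula. *)
Lemma ns_law_sum (P : box) (w : 'I_m1 * 'I_m2) (p : pred 'I_m1) (q : pred 'I_m2) :
  \sum_x \sum_y1 \sum_y2 \sum_(d1 | p d1) \sum_(d2 | q d2)
     ns_law (@ex_chan R) P w x y1 y2 d1 d2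
  = (m1 * m2)%:R^-1 * (2^-1 ^+ n * \sum_b \sum_x
      \sum_(d1 | p d1) \sum_(d2 | q d2) P w (in1 x) (rx2 x b) x d1 d2).
Proof.
rewrite [X in _ = _ * (_ * X)]exchange_big /= mulrA mulr_sumr; apply: eq_bigr => x _.
rewrite -mulrA -(chan_sum x (fun y1 y2 =>
  \sum_(d1 | p d1) \sum_(d2 | q d2) P w y1 y2 x d1 d2)) mulr_sumr.
apply: eq_bigr => y1 _; rewrite mulr_sumr; apply: eq_bigr => y2 _.
rewrite mulrA -sumP2; apply: eq_bigr => d1 _; apply: eq_bigr => d2 _.
by rewrite /ns_law mulrAC.
Qed.

(** Here the receivers' inputs depend on the output [x], so normalization does not apply directly.
    Since the marginal of [x] ignores the receivers' inputs, these may first be replaced by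
    constants. *)
Lemma ns_box_total (P : box) (w : 'I_m1 * 'I_m2) (b : {ffun 'I_n -> bool}) :
  ns_box P ->
  \sum_x \sum_d1 \sum_d2 P w (in1 x) (rx2 x b) x d1 d2 = 1.
Proof.
case=> _ P1 _ [Pns _ _].
rewrite -(P1 w (finfun (fun _ => 0)) (finfun (fun _ => 0))).
by apply: eq_bigr => x _; apply: Pns.
Qed.

(** Success probability of Rx-1 scaled by [m1 * m2], which keeps the counting arguments free of
    divisions. *)
Definition ns_succ1 (P : box) : R :=
  \sum_(w : 'I_m1 * 'I_m2) 2^-1 ^+ n * \sum_b \sum_x
    \sum_d2 P w (in1 x) (rx2 x b) x w.1 d2.

Definition ns_succ2 (P : box) : R :=
  \sum_(w : 'I_m1 * 'I_m2) 2^-1 ^+ n * \sum_b \sum_x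
    \sum_d1 P w (in1 x) (rx2 x b) x d1 w.2.

Let sum_one : \sum_(w : 'I_m1 * 'I_m2) 1 = (m1 * m2)%:R :> R.
Proof. by rewrite sumr_const card_prod !card_ord. Qed.

Let m_neq0 : (m1 * m2)%:R != 0 :> R.
Proof. by rewrite pnatr_eq0 -lt0n muln_gt0 m1_gt0. Qed.

Lemma err1E (P : box) : ns_box P ->
  err1 (ns_law (@ex_chan R) P) = 1 - (m1 * m2)%:R^-1 * ns_succ1 P.
Proof.
move=> nsP; rewrite /err1; under eq_bigr => w _ do rewrite ns_law_sum.
rewrite -mulr_sumr /ns_succ1 -[X in X - _](mulVf m_neq0) -mulrBr -sum_one.
rewrite -sumrB; congr (_ * _); apply: eq_bigr => w _.
rewrite -[X in X - _](@mean_bool R n) -mulrBr -sumrB; congr (_ * _).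
apply: eq_bigr => b _; rewrite -(ns_box_total w b nsP) -sumrB.
apply: eq_bigr => x _; rewrite [X in _ = X - _](bigD1 w.1) //=.
by rewrite addrAC subrr add0r.
Qed.

Lemma err2E (P : box) : ns_box P ->
  err2 (ns_law (@ex_chan R) P) = 1 - (m1 * m2)%:R^-1 * ns_succ2 P.
Proof.
move=> nsP; rewrite /err2; under eq_bigr => w _ do rewrite ns_law_sum.
rewrite -mulr_sumr /ns_succ2 -[X in X - _](mulVf m_neq0) -mulrBr -sum_one.
rewrite -sumrB; congr (_ * _); apply: eq_bigr => w _.
rewrite -[X in X - _](@mean_bool R n) -mulrBr -sumrB; congr (_ * _).
apply: eq_bigr => b _; rewrite -(ns_box_total w b nsP) -sumrB.
apply: eq_bigr => x _; rewrite -sumrB; apply: eq_bigr => d1 _.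
by rewrite [X in _ = X - _](bigD1 w.2) //= addrAC subrr add0r.
Qed.

Let mean_le (F : {ffun 'I_n -> bool} -> R) c :
  (forall b, F b <= c) -> 2^-1 ^+ n * \sum_b F b <= c.
Proof.
move=> Fc; rewrite -[leRHS](@mean_bool R n).
by apply: ler_wpM2l (ler_sum _ _) => //; rewrite exprn_ge0 // invr_ge0 ler0n.
Qed.

(** Success on the input [in1 x] is at most the sum, over all fixed inputs [y], of the probability
    that Rx-1 outputs [w.1]. By non-signaling that probability is the same for all transmitter
    inputs, so summing over [w.1] gives 1 for each of the 3^n words [y]. *)
Lemma ns_succ1_le (P : box) : ns_box P -> ns_succ1 P <= (m2 * 3 ^ n)%:R.
Proof.
case=> P0 P1 [Pns2 _ _] [_ Pns1 _].
pose w0 : 'I_m1 * 'I_m2 := (Ordinal m1_gt0, Ordinal m2_gt0).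
pose z : {ffun 'I_n -> F3 * F3} := finfun (fun _ => 0).
pose M y d1 := \sum_x \sum_d2 P w0 y z x d1 d2.
have -> : (m2 * 3 ^ n)%:R = \sum_(w : 'I_m1 * 'I_m2) \sum_y M y w.1.
  rewrite -(pair_big xpredT xpredT (fun d1 _ => \sum_y M y d1)) exchange_big /=.
  under eq_bigr => j _ do rewrite exchange_big /=.
  under eq_bigr => j _.
    under eq_bigr => y _ do rewrite /M exchange_big /= P1.
    rewrite sumr_const card_vec; over.
  by rewrite sumr_const card_ord -mulrnA mulnC.
apply: ler_sum => w _; apply: mean_le => b.
under [leRHS]eq_bigr => y _ do rewrite /M (Pns1 w0 w _ _ z).
rewrite [leRHS]exchange_big; apply: ler_sum => x _ /=.
(* Only the term [y = in1 x] is the true one; the others are nonnegative. *)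
rewrite (bigD1 (in1 x)) //= (Pns2 _ _ _ z) lerDl.
by apply: sumr_ge0 => y _; apply: sumr_ge0 => d2 _.
Qed.

(** The argument for Rx-1 is run for each fixed [b]: with the signs frozen, Rx-2 has only 3^n
    possible observations. *)
Lemma ns_succ2_le (P : box) : ns_box P -> ns_succ2 P <= (m1 * 3 ^ n)%:R.
Proof.
case=> P0 P1 [_ Pns1 _] [_ _ Pns2].
pose w0 : 'I_m1 * 'I_m2 := (Ordinal m1_gt0, Ordinal m2_gt0).
pose z : vec n := finfun (fun _ => 0).
pose obs (b : {ffun 'I_n -> bool}) (y : vec n) : {ffun 'I_n -> F3 * F3} :=
  [ffun i => (y i, sgn3 (b i))].
pose M b y d2 := \sum_x \sum_d1 P w0 z (obs b y) x d1 d2.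
rewrite /ns_succ2 -mulr_sumr exchange_big /=; apply: mean_le => b.
have -> : (m1 * 3 ^ n)%:R = \sum_(w : 'I_m1 * 'I_m2) \sum_y M b y w.2.
  rewrite -(pair_big xpredT xpredT (fun _ d2 => \sum_y M b y d2)) /=.
  under eq_bigr => j _ do rewrite exchange_big /=.
  under eq_bigr => j _.
    under eq_bigr => y _.
      rewrite /M exchange_big /=.
      under eq_bigr => x _ do rewrite exchange_big /=.
      rewrite P1; over.
    rewrite sumr_const card_vec; over.
  by rewrite sumr_const card_ord -mulrnA mulnC.
apply: ler_sum => w _.
under [leRHS]eq_bigr => y _ do rewrite /M (Pns2 w0 w _ z).
rewrite [leRHS]exchange_big; apply: ler_sum => x _ /=.
have -> : rx2 x b = obs b [ffun i => sgn3 (b i) * (x i).1 + (x i).2].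
  by apply/ffunP => i; rewrite !ffunE.
rewrite (bigD1 [ffun i => sgn3 (b i) * (x i).1 + (x i).2]) //=.
rewrite (Pns1 _ (in1 x) z) lerDl.
by apply: sumr_ge0 => y _; apply: sumr_ge0 => d2 _.
Qed.

End Schemes.

(** * A perfect non-signaling scheme *)

Section Words.
Variable n : nat.

Definition word (i : 'I_(3 ^ n)) : vec n :=
  enum_val (cast_ord (esym (card_vec n)) i).

Definition word_index (v : vec n) : 'I_(3 ^ n) :=
  cast_ord (card_vec n) (enum_rank v).

Lemma wordK : cancel word word_index.
Proof. by move=> i; rewrite /word_index /word enum_valK cast_ordKV. Qed.

Lemma word_indexK : cancel word_index word.
Proof. by move=> v; rewrite /word_index /word cast_ordK enum_rankK. Qed.

End Words.

Lemma sum_indicator1 (R : realType) (T : finType) (c : bool) (t0 : T) :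
  \sum_t (c && (t == t0))%:R = c%:R :> R.
Proof.
rewrite (bigD1 t0) //= eqxx andbT big1 ?addr0 // => t /negPf->.
by rewrite andbF.
Qed.

Section PerfectBox.
Variables (R : realType) (n : nat).

(** The word [y + V] that Rx-2 must output, after solving [U + V = - G X1] with [U = x.2 - w2]. *)
Definition shift_out (w : 'I_(3 ^ n) * 'I_(3 ^ n))
    (y2 x : {ffun 'I_n -> F3 * F3}) : vec n :=
  [ffun i => (y2 i).1 - (y2 i).2 * word w.1 i - (x i).2 + word w.2 i].

(* The shared output U of the transmitter is x.2 - w2, and that of Rx-2 is
   V = d2 - y. *)
Definition perfect_box : box R n (3 ^ n) (3 ^ n) := fun w y1 y2 x d1 d2 =>
  (3 ^ n)%:R^-1 * [&& in1 x == word w.1, d1 == word_index y1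
                   & d2 == word_index (shift_out w y2 x)]%:R.

Let sum_d2 w y1 y2 x d1 : \sum_d2 perfect_box w y1 y2 x d1 d2
  = (3 ^ n)%:R^-1 * ((in1 x == word w.1) && (d1 == word_index y1))%:R.
Proof.
rewrite -mulr_sumr; congr (_ * _).
by under eq_bigr => d2 _ do rewrite andbA; rewrite sum_indicator1.
Qed.

Let sum_d1 w y1 y2 x d2 : \sum_d1 perfect_box w y1 y2 x d1 d2
  = (3 ^ n)%:R^-1 *
    ((in1 x == word w.1) && (d2 == word_index (shift_out w y2 x)))%:R.
Proof.
rewrite -mulr_sumr; congr (_ * _).
by under eq_bigr => d1 _ do rewrite andbCA andbC;
  rewrite sum_indicator1.
Qed.

(** Given [w], [y2] and [d2], exactly one [x] is compatible, namely [x0] below. So to the receivers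
    [d2] looks uniform, whatever [w] and [y2] are. *)
Let sum_x w y1 y2 d1 d2 : \sum_x perfect_box w y1 y2 x d1 d2
  = (3 ^ n)%:R^-1 * (d1 == word_index y1)%:R.
Proof.
rewrite -mulr_sumr; congr (_ * _).
pose x0 : {ffun 'I_n -> F3 * F3} := [ffun i =>
  (word w.1 i, (y2 i).1 - (y2 i).2 * word w.1 i - word d2 i + word w.2 i)].
rewrite -[RHS](@sum_indicator1 R _ _ x0); apply: eq_bigr => x _.
rewrite andbCA; congr (_ && _)%:R.
apply/andP/eqP => [[/eqP h1 /eqP h2]|->]; last first.
  split; apply/eqP; first by apply/ffunP => i; rewrite !ffunE.
  rewrite -[LHS]wordK; congr word_index; apply/ffunP => i.
  rewrite !ffunE /=; ring.
apply/ffunP => i; rewrite [RHS]ffunE h2 word_indexK -h1 !ffunE -h1 !ffunE.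
rewrite [LHS]surjective_pairing; congr (_, _); ring.
Qed.

Let sum_d1d2 y1 : \sum_(d1 < 3 ^ n) \sum_(d2 < 3 ^ n)
  (3 ^ n)%:R^-1 * (d1 == word_index y1)%:R = 1 :> R.
Proof.
rewrite exchange_big /=.
under eq_bigr => d2 _.
  rewrite -mulr_sumr (eq_bigr (fun d => (true && (d == word_index y1))%:R)) //.
  rewrite sum_indicator1 mulr1; over.
by rewrite sumr_const card_ord -[LHS]mulr_natl divff // pnatr_eq0 expn_eq0.
Qed.

Lemma perfect_box_ns : ns_box perfect_box.
Proof.
split.
- by move=> *; rewrite mulr_ge0 // ?invr_ge0 ler0n.
- move=> w y1 y2; rewrite -(sum_d1d2 y1) exchange_big; apply: eq_bigr => d1 _.
  by rewrite exchange_big; apply: eq_bigr => d2 _ /=; rewrite sum_x.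
- split=> *; first by rewrite !sum_d2.
  + by rewrite !sum_d1.
  + by rewrite !sum_x.
- split=> [w y1 y2 y1' y2' x | w w' y1 y2 y2' d1 | w w' y1 y1' y2 d2].
  + under eq_bigr do rewrite sum_d2; under [RHS]eq_bigr do rewrite sum_d2.
    by rewrite -!mulr_sumr !sum_indicator1.
  + rewrite exchange_big [RHS]exchange_big; apply: eq_bigr => d2 _ /=.
    by rewrite !sum_x.
  + rewrite exchange_big [RHS]exchange_big /=.
    under eq_bigr do rewrite sum_x -[_ == _]andTb.
    under [RHS]eq_bigr do rewrite sum_x -[_ == _]andTb.
    by rewrite -!mulr_sumr !sum_indicator1.
Qed.

Lemma perfect_box_scheme : ns_scheme (@ex_chan R) n (3 ^ n) (3 ^ n) 0 0.
Proof.
exists perfect_box; split; first exact: perfect_box_ns.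
- rewrite /err1 big1 // => w _; rewrite ns_law_sum.
  rewrite (big1 _ _ (fun b : {ffun _ -> bool} => _)) ?mulr0 // => b _.
  rewrite big1 // => x _; rewrite big1 // => d1 d1w; rewrite big1 // => d2 _.
  rewrite /perfect_box; case: eqP => [->|_]; last by rewrite mulr0.
  by rewrite wordK (negPf d1w) mulr0.
- rewrite /err2 big1 // => w _; rewrite ns_law_sum.
  rewrite (big1 _ _ (fun b : {ffun _ -> bool} => _)) ?mulr0 // => b _.
  rewrite big1 // => x _; rewrite big1 // => d1 _; rewrite big1 // => d2 d2w.
  rewrite /perfect_box; case: eqP => [xw|_]; last by rewrite mulr0.
  (* On a true channel output [y = G x.1 + x.2], so everything but [w2] cancels. *)
  have -> : shift_out w (rx2 x b) x = word w.2.
    by apply/ffunP => i; rewrite !ffunE -xw ffunE /=; ring.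
  by rewrite wordK (negPf d2w) andbF mulr0.
Qed.

End PerfectBox.

(** * Classical schemes *)

Section Classical.
Variables (R : realType) (n m1 m2 : nat).
Hypotheses (m1_gt0 : (0 < m1)%N) (m2_gt0 : (0 < m2)%N).
Variables (E : 'I_m1 * 'I_m2 -> {ffun 'I_n -> F3 * F3} -> R)
  (D1 : vec n -> 'I_m1 -> R) (D2 : {ffun 'I_n -> F3 * F3} -> 'I_m2 -> R).
Hypotheses (hE : is_cpmf E) (hD1 : is_cpmf D1) (hD2 : is_cpmf D2).

(** A classical scheme seen as a box with independent parties, so that the error formulas and bounds
    for boxes apply to it. *)
Definition product_box : box R n m1 m2 :=
  fun w y1 y2 x d1 d2 => E w x * D1 y1 d1 * D2 y2 d2.

Lemma classical_lawE :
  classical_law (@ex_chan R) E D1 D2 = ns_law (@ex_chan R) product_box.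
Proof.
apply/funext => w; apply/funext => x; apply/funext => y1; apply/funext => y2.
apply/funext => d1; apply/funext => d2.
rewrite /classical_law /ns_law /product_box; ring.
Qed.

Let sum_d2 w y1 y2 x d1 : \sum_d2 product_box w y1 y2 x d1 d2 = E w x * D1 y1 d1.
Proof. by rewrite -mulr_sumr hD2.2 mulr1. Qed.

Let sum_d1 w y1 y2 x d2 : \sum_d1 product_box w y1 y2 x d1 d2 = E w x * D2 y2 d2.
Proof. by rewrite -mulr_suml -mulr_sumr hD1.2 mulr1. Qed.

Let sum_x w y1 y2 d1 d2 : \sum_x product_box w y1 y2 x d1 d2 = D1 y1 d1 * D2 y2 d2.
Proof. by rewrite -!mulr_suml hE.2 mul1r. Qed.

Lemma product_box_ns : ns_box product_box.
Proof.
split.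
- by move=> *; rewrite !mulr_ge0 //; [apply: hE.1 | apply: hD1.1 | apply: hD2.1].
- move=> w y1 y2; under eq_bigr do under eq_bigr do rewrite sum_d2.
  by under eq_bigr do rewrite -mulr_sumr hD1.2 mulr1; rewrite hE.2.
- by split=> *; rewrite ?sum_d2 ?sum_d1 ?sum_x.
- split=> [w y1 y2 y1' y2' x | w w' y1 y2 y2' d1 | w w' y1 y1' y2 d2].
  + under eq_bigr do rewrite sum_d2; under [RHS]eq_bigr do rewrite sum_d2.
    by rewrite -!mulr_sumr !hD1.2.
  + under eq_bigr do rewrite sum_d2; under [RHS]eq_bigr do rewrite sum_d2.
    by rewrite -!mulr_suml !hE.2.
  + under eq_bigr do rewrite sum_d1; under [RHS]eq_bigr do rewrite sum_d1.
    by rewrite -!mulr_suml !hE.2.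
Qed.

(** * Classical converse: comparing a sign sequence with its opposite *)

Local Notation mean F := (2^-1 ^+ n * \sum_(b : {ffun 'I_n -> bool}) F b).

Definition flip (b : {ffun 'I_n -> bool}) : {ffun 'I_n -> bool} :=
  [ffun i => ~~ b i].

Lemma flipK : involutive flip.
Proof. by move=> b; apply/ffunP => i; rewrite !ffunE negbK. Qed.

Lemma succ1_product : ns_succ1 product_box
  = mean (fun _ => \sum_w \sum_x E w x * D1 (in1 x) w.1).
Proof.
rewrite mean_bool; apply: eq_bigr => w _; rewrite -[RHS](@mean_bool R n).
by congr (_ * _); apply: eq_bigr => b _; apply: eq_bigr => x _; rewrite sum_d2.
Qed.

Lemma succ2_product : ns_succ2 product_box
  = mean (fun b => \sum_w \sum_x E w x * D2 (rx2 x b) w.2).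
Proof.
rewrite exchange_big mulr_sumr; apply: eq_bigr => w _; congr (_ * _).
by apply: eq_bigr => b _; apply: eq_bigr => x _; rewrite sum_d1.
Qed.

Lemma succ2_product_flip : ns_succ2 product_box
  = mean (fun b => \sum_w \sum_x E w x * D2 (rx2 x (flip b)) w.2).
Proof. by rewrite succ2_product (reindex_inj (inv_inj flipK)). Qed.

Lemma cpmf_le1 (S T : finType) (K : S -> T -> R) s t : is_cpmf K -> K s t <= 1.
Proof.
case=> K0 K1; rewrite -(K1 s) (bigD1 t) //= lerDl.
by apply: sumr_ge0 => t' _.
Qed.

(** Summed over the first message: the probability that Rx-1 is right and that Rx-2, run
    independently on the outputs for [b] and for [flip b], finds [d2] both times. *)
Definition joint_succ (b : {ffun 'I_n -> bool}) (d2 : 'I_m2) : R :=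
  \sum_d1 \sum_x E (d1, d2) x * D1 (in1 x) d1 * D2 (rx2 x b) d2
    * D2 (rx2 x (flip b)) d2.

(** A union bound over three failures, [p q r >= p + q + r - 2] on [0, 1], where
    [succ2_product_flip] supplies the third success. *)
Lemma joint_succ_ge :
  ns_succ1 product_box + 2 * ns_succ2 product_box - 2 * (m1 * m2)%:R
  <= mean (fun b => \sum_d2 joint_succ b d2).
Proof.
have -> : (m1 * m2)%:R = mean (fun _ => \sum_w \sum_x E w x).
  rewrite mean_bool (eq_bigr (fun _ => 1)) => [|w _]; last exact: hE.2.
  by rewrite sumr_const card_prod !card_ord.
have dbl (t : R) : 2 * t = t + t by ring.
rewrite !dbl {1}succ2_product succ2_product_flip.
have factor (k p q r t : R) :
  k * p + (k * q + k * r) - (k * t + k * t) = k * (p + (q + r) - (t + t)) by ring.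
rewrite succ1_product factor; apply: ler_wpM2l.
  by rewrite exprn_ge0 // invr_ge0 ler0n.
rewrite -!big_split -sumrB; apply: ler_sum => b _ /=.
have -> : \sum_d2 joint_succ b d2 = \sum_w \sum_x E w x * D1 (in1 x) w.1
    * D2 (rx2 x b) w.2 * D2 (rx2 x (flip b)) w.2.
  rewrite /joint_succ exchange_big pair_big /=.
  by apply: eq_bigr => -[d1 d2] _.
rewrite -!big_split -sumrB; apply: ler_sum => w _ /=.
rewrite -!big_split -sumrB; apply: ler_sum => x _ /=.
have {}factor (k p q r : R) :
  k * p + (k * q + k * r) - (k + k) = k * (p + (q + r) - 2) by ring.
rewrite factor -!mulrA; apply: ler_wpM2l; first exact: hE.1.
have := hD1.1 (in1 x) w.1; have := cpmf_le1 (in1 x) w.1 hD1.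
have := hD2.1 (rx2 x b) w.2; have := cpmf_le1 (rx2 x b) w.2 hD2.
have := hD2.1 (rx2 x (flip b)) w.2; have := cpmf_le1 (rx2 x (flip b)) w.2 hD2.
move: (D1 _ _) (D2 _ _) (D2 _ _) => p q r r1 r0 q1 q0 p1 p0.
(* This product and the next add up to [p q r - p - q - r + 2]. *)
have : 0 <= (1 - q) * (1 - r) by rewrite mulr_ge0 ?subr_ge0.
have : 0 <= (1 - p) * (1 - q * r).
  by rewrite mulr_ge0 ?subr_ge0 // mulr_ile1.
rewrite !mulrA; lra.
Qed.

(** The count A_g(w2), with decoding probabilities as weights since the decoder is stochastic. *)
Definition accept (b : {ffun 'I_n -> bool}) (d2 : 'I_m2) : R :=
  \sum_(y : vec n) D2 [ffun i => (y i, sgn3 (b i))] d2.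

Lemma sum_accept b : \sum_d2 accept b d2 = (3 ^ n)%:R.
Proof.
rewrite exchange_big /=; under eq_bigr do rewrite hD2.2.
by rewrite sumr_const card_vec.
Qed.

Lemma accept_ge0 b d2 : 0 <= accept b d2.
Proof. by apply: sumr_ge0 => y _; apply: hD2.1. Qed.

(* Each input sequence x is determined by the two outputs it would produce
   under G = b and under G = - b. *)
Lemma joint_succ_le_accept b d2 :
  joint_succ b d2 <= accept b d2 * accept (flip b) d2.
Proof.
pose dif b' (x : {ffun 'I_n -> F3 * F3}) : vec n :=
  [ffun i => sgn3 (b' i) * (x i).1 + (x i).2].
have rx2E x b' : rx2 x b' = [ffun i => (dif b' x i, sgn3 (b' i))].
  by apply/ffunP => i; rewrite !ffunE.
have dif_inj : injective (fun x => (dif b x, dif (flip b) x)).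
  move=> x x' [/ffunP e1 /ffunP e2]; apply/ffunP => i.
  have h1 := e1 i; have h2 := e2 i; move: h1 h2; rewrite !ffunE sgn3N.
  move: (x i) (x' i) (b i).
  suff h : forall u v : F3 * F3, forall c : bool,
     (sgn3 c * u.1 + u.2 == sgn3 c * v.1 + v.2) ==>
     (- sgn3 c * u.1 + u.2 == - sgn3 c * v.1 + v.2) ==> (u == v).
    by move=> u v c /eqP h1 /eqP h2; apply/eqP; have := h u v c; rewrite h1 h2.
  (* True because 2 is invertible in F_3; checked on all cases. *)
  move=> [u1 u2] [v1 v2] c; move: u1 u2 v1 v2 c.
  by do 4!(case; case=> [|[|[|]]] // ?); case; vm_compute.
have dif_bij : bijective (fun x => (dif b x, dif (flip b) x)).
  by apply: (inj_card_bij dif_inj); rewrite card_prod !card_vec card_ffun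
    card_prod !card_ord expnMn.
rewrite /accept mulr_suml.
under [leRHS]eq_bigr do rewrite mulr_sumr.
rewrite pair_big /= (reindex _ (onW_bij _ dif_bij)) /= /joint_succ exchange_big.
apply: ler_sum => x _; rewrite !rx2E /=.
set p := D2 _ _; set q := D2 _ _.
rewrite -[leRHS]mul1r; under eq_bigr do rewrite -mulrA.
rewrite -mulr_suml; apply: ler_wpM2r; first by rewrite mulr_ge0 // hD2.1.
(* Rx-1's decision depends on [x] alone and has total mass 1, so each [x] serves at most one first
   message. *)
rewrite -(hD1.2 (in1 x)); apply: ler_sum => d1 _.
by rewrite ler_piMl ?hD1.1 // cpmf_le1.
Qed.

Lemma joint_succ_le_size b d2 : joint_succ b d2 <= m1%:R.
Proof.
rewrite -[X in X%:R]card_ord -sumr_const; apply: ler_sum => d1 _.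
rewrite -(hE.2 (d1, d2)); apply: ler_sum => x _.
rewrite -!mulrA ler_piMr ?hE.1 // !mulr_ile1 ?mulr_ge0 //;
  by [exact: hD1.1 | exact: hD2.1 | exact: cpmf_le1].
Qed.

Lemma joint_succ_ge0 b d2 : 0 <= joint_succ b d2.
Proof.
apply: sumr_ge0 => d1 _; apply: sumr_ge0 => x _.
by rewrite !mulr_ge0 ?hE.1 ?hD1.1 ?hD2.1.
Qed.

(** Geometric mean of the two preceding upper bounds, then AM-GM. The result is linear in [accept],
    whose sum over [d2] is known. *)
Lemma joint_succ_le_sqrt b d2 :
  joint_succ b d2 <= Num.sqrt m1%:R * ((accept b d2 + accept (flip b) d2) / 2).
Proof.
have [[J0 A0] A1] := (joint_succ_ge0 b d2, accept_ge0 b d2, accept_ge0 (flip b) d2).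
have M0 : 0 <= m1%:R :> R by rewrite ler0n.
have S0 : 0 <= Num.sqrt m1%:R * ((accept b d2 + accept (flip b) d2) / 2).
  by rewrite mulr_ge0 ?sqrtr_ge0 // divr_ge0 ?addr_ge0.
rewrite -(ler_pXn2r (ltn0Sn 1)) ?nnegrE //.
rewrite [leRHS]exprMn sqr_sqrtr // expr2.
apply: le_trans (ler_pM J0 J0 (joint_succ_le_size b d2)
  (joint_succ_le_accept b d2)) _.
apply: ler_wpM2l => //.
have := sqr_ge0 (accept b d2 - accept (flip b) d2); rewrite expr2; nra.
Qed.

Lemma classical_succ_le :
  ns_succ1 product_box + 2 * ns_succ2 product_box - 2 * (m1 * m2)%:R
  <= Num.sqrt m1%:R * (3 ^ n)%:R.
Proof.
apply: le_trans joint_succ_ge _.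
rewrite -[leRHS](@mean_bool R n); apply: ler_wpM2l.
  by rewrite exprn_ge0 // invr_ge0 ler0n.
apply: ler_sum => b _.
apply: le_trans (ler_sum _ (fun d2 _ => joint_succ_le_sqrt b d2)) _.
rewrite -mulr_sumr -mulr_suml big_split /= !sum_accept.
by rewrite ler_wpM2l ?sqrtr_ge0 //; lra.
Qed.

End Classical.

(** * Rates *)

Lemma ns_scheme_size (R : realType) n m1 m2 (e1 e2 : R) :
  (0 < m1)%N -> (0 < m2)%N -> ns_scheme (@ex_chan R) n m1 m2 e1 e2 ->
  (1 - e1) * m1%:R <= 3 ^+ n /\ (1 - e2) * m2%:R <= 3 ^+ n.
Proof.
move=> m1_gt0 m2_gt0 [P [nsP <- <-]]; rewrite err1E // err2E //.
have m1R : 0 < m1%:R :> R by rewrite ltr0n.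
have m2R : 0 < m2%:R :> R by rewrite ltr0n.
have := ns_succ1_le m1_gt0 m2_gt0 nsP; have := ns_succ2_le m1_gt0 m2_gt0 nsP.
rewrite !natrM !natrX; move: (ns_succ1 _) (ns_succ2 _) => S1 S2 h2 h1.
split.
- rewrite -(ler_pM2r m2R); apply: le_trans (_ : S1 <= _); last by rewrite mulrC.
  by rewrite (_ : _ * _ = S1) //; field; rewrite !gt_eqF.
- rewrite -(ler_pM2r m1R); apply: le_trans (_ : S2 <= _); last by rewrite mulrC.
  by rewrite (_ : _ * _ = S2) //; field; rewrite !gt_eqF.
Qed.

Lemma classical_ns_scheme (R : realType) n m1 m2 (e1 e2 : R) :
  classical_scheme (@ex_chan R) n m1 m2 e1 e2 ->
  ns_scheme (@ex_chan R) n m1 m2 e1 e2.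
Proof.
case=> [E [D1 [D2 [hE hD1 hD2 <- <-]]]]; exists (product_box E D1 D2).
by split; [exact: product_box_ns | rewrite classical_lawE..].
Qed.

Lemma classical_scheme_size (R : realType) n m1 m2 (e1 e2 : R) :
  (0 < m1)%N -> (0 < m2)%N -> classical_scheme (@ex_chan R) n m1 m2 e1 e2 ->
  (1 - e1 - 2 * e2) * (m2%:R * Num.sqrt m1%:R) <= 3 ^+ n.
Proof.
move=> m1_gt0 m2_gt0 [E [D1 [D2 [hE hD1 hD2 <- <-]]]].
have nsP := product_box_ns hE hD1 hD2.
have := classical_succ_le hE hD1 hD2.
rewrite !classical_lawE err1E // err2E // natrM natrX.
move: (ns_succ1 _) (ns_succ2 _) => S1 S2.
have m1R : 0 < m1%:R :> R by rewrite ltr0n.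
have m2R : 0 < m2%:R :> R by rewrite ltr0n.
have s0 : 0 < Num.sqrt m1%:R :> R by rewrite sqrtr_gt0.
(* The factor [1 - e1 - 2 * e2] is [S1 + 2 S2 - 2 m1 m2] over [m1 m2]. Writing [m1] as a square lets
   one root cancel. *)
have sE : m1%:R = Num.sqrt m1%:R * Num.sqrt m1%:R :> R.
  by rewrite -expr2 sqr_sqrtr // ltW.
move: (Num.sqrt _) s0 sE => s s0 ->{m1R} h.
rewrite -(ler_pM2l s0); apply: le_trans h.
by rewrite le_eqVlt; apply/predU1P; left; field; rewrite !gt_eqF // mulr_gt0.
Qed.

Section Rates.
Variable R : realType.
Local Open Scope classical_set_scope.

Lemma log2_le (x y : R) : 0 < x -> x <= y -> log2 x <= log2 y.
Proof.
move=> x0 xy; rewrite ler_pM2r; last by rewrite invr_gt0 ln_gt0 // ltr1n.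
by rewrite ler_ln ?posrE // (lt_le_trans x0).
Qed.

Lemma log2M (x y : R) : 0 < x -> 0 < y -> log2 (x * y) = log2 x + log2 y.
Proof. by move=> x0 y0; rewrite /log2 lnM ?posrE // mulrDl. Qed.

Lemma log2Xn (x : R) n : 0 < x -> log2 (x ^+ n) = n%:R * log2 x.
Proof. by move=> x0; rewrite /log2 lnXn // -[ln x *+ n]mulr_natl mulrA. Qed.

Lemma log2_2 : log2 2 = 1 :> R.
Proof. by rewrite /log2 divff // gt_eqF // ln_gt0 ?ltr1n. Qed.

Lemma cvg_divn (c : R) : (fun n => c / n%:R) @ \oo --> (0 : R).
Proof.
rewrite -(mulr0 c); apply: cvgMl_tmp; rewrite -cvg_shiftS; exact: cvg_harmonic.
Qed.

(** The constant [K] disappears after division by [n], so constant factors in the size bounds are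
    harmless. *)
Lemma rate_limit_le (u : nat -> R) (c K l : R) :
  (\forall n \near \oo, u n <= K + n%:R * c) ->
  (fun n => u n / n%:R) @ \oo --> l -> l <= c.
Proof.
move=> uK ul.
have cK : (fun n => K / n%:R + c) @ \oo --> c.
  by rewrite -[X in _ --> X]add0r; apply: cvgD; [exact: cvg_divn | exact: cvg_cst].
apply: ler_cvg_to ul cK _; near=> n.
have n0 : 0 < n%:R :> R by rewrite ltr0n; near: n; exact: nbhs_infty_gt.
rewrite ler_pdivrMr // mulrDl divfK ?gt_eqF // mulrC.
by near: n.
Unshelve. all: by end_near. Qed.

Lemma small_errors (e1 e2 : nat -> R) (d : R) : 0 < d ->
  (fun n => Num.max (e1 n) (e2 n)) @ \oo --> (0 : R) ->
  \forall n \near \oo, e1 n < d /\ e2 n < d.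
Proof.
move=> d0 /cvgr0_norm_lt/(_ _ d0); apply: filterS => n.
move=> /(le_lt_trans (ler_norm _)); rewrite gt_max.
by move=> /andP.
Qed.

(** A closed half-plane containing the achievable pairs contains their closure. *)
Lemma capacity_region_le scheme (c : R) :
  (forall r : R * R, achievable scheme r -> r.1 + r.2 <= c) ->
  forall r : R * R, capacity_region scheme r -> r.1 + r.2 <= c.
Proof.
move=> h; pose H := (fun r : R * R => r.1 + r.2) @^-1` [set x | x <= c].
have Hc : closed H.
  apply: preimage_closed; last exact: closed_le.
  by move=> r _; apply: cvgD; [exact: cvg_fst | exact: cvg_snd].
by move=> r; rewrite /capacity_region => /(closure_subset h); rewrite -(closure_id H).1.
Qed.

Lemma NS_rate_le (r : R * R) :
  achievable (fun n m1 m2 e1 e2 => ns_scheme (@ex_chan R) n m1 m2 e1 e2) r ->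
  r.1 <= log2 3 /\ r.2 <= log2 3.
Proof.
move=> [m1 [m2 [e1 [e2 [m0 sch e0 [l1 [hl1 r1]] [l2 [hl2 r2]]]]]]].
have half : 0 < 2^-1 :> R by rewrite invr_gt0.
(* Error below 1/2 gives [m <= 2 * 3 ^ n]; the factor 2 costs one bit in all. *)
have main (m : nat) e n : (0 < m)%N -> e < 2^-1 :> R ->
    (1 - e) * m%:R <= 3 ^+ n -> log2 m%:R <= 1 + n%:R * log2 (3 : R).
  move=> mgt0 eh h; have mR : 0 < m%:R :> R by rewrite ltr0n.
  rewrite -[X in X + _]log2_2 -log2Xn // -log2M ?exprn_gt0 //; apply: log2_le => //.
  by nra.
split; [apply: le_trans r1 _|apply: le_trans r2 _].
- apply: (rate_limit_le _ hl1); near=> n.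
  have [e1n _] : e1 n < 2^-1 /\ e2 n < 2^-1 by near: n; exact: small_errors.
  have [? ?] := m0 n.
  by apply: main e1n _ => //; have [] := ns_scheme_size _ _ (sch n).
- apply: (rate_limit_le _ hl2); near=> n.
  have [_ e2n] : e1 n < 2^-1 /\ e2 n < 2^-1 by near: n; exact: small_errors.
  have [? ?] := m0 n.
  by apply: main e2n _ => //; have [] := ns_scheme_size _ _ (sch n).
Unshelve. all: by end_near. Qed.

Lemma classical_achievableNS (r : R * R) :
  achievable (fun n m1 m2 e1 e2 => classical_scheme (@ex_chan R) n m1 m2 e1 e2) r ->
  achievable (fun n m1 m2 e1 e2 => ns_scheme (@ex_chan R) n m1 m2 e1 e2) r.
Proof.
move=> [m1 [m2 [e1 [e2 [? sch ? ? ?]]]]]; exists m1, m2, e1, e2; split=> // n.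
exact: classical_ns_scheme (sch n).
Qed.

Lemma classical_rate_le (r : R * R) :
  achievable (fun n m1 m2 e1 e2 => classical_scheme (@ex_chan R) n m1 m2 e1 e2) r ->
  r.1 + r.2 <= 3 / 2 * log2 3.
Proof.
move=> hr; have [r1_le _] := NS_rate_le (classical_achievableNS hr).
move: hr => [m1 [m2 [e1 [e2 [m0 sch e0 [l1 [hl1 r1]] [l2 [hl2 r2]]]]]]].
(* Averaging this bound with [r.1 <= log2 3] gives the sum rate. *)
suff : l1 + 2 * l2 <= 2 * log2 3 by lra.
apply: (@rate_limit_le (fun n => log2 (m1 n)%:R + 2 * log2 (m2 n)%:R) _ 2).
  near=> n.
  (* Then [1 - e1 - 2 * e2] exceeds 5/8, hence 1/2, so [m2 * sqrt m1 <= 2 * 3 ^ n]. *)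
  have [e1n e2n] : e1 n < 8^-1 /\ e2 n < 8^-1.
    by near: n; apply: small_errors => //; rewrite invr_gt0.
  have [m1n m2n] := m0 n; have := classical_scheme_size m1n m2n (sch n).
  have m1R : 0 < (m1 n)%:R :> R by rewrite ltr0n.
  have m2R : 0 < (m2 n)%:R :> R by rewrite ltr0n.
  have s0 : 0 < Num.sqrt (m1 n)%:R :> R by rewrite sqrtr_gt0.
  have -> : (m1 n)%:R = Num.sqrt (m1 n)%:R ^+ 2 :> R by rewrite sqr_sqrtr // ltW.
  rewrite [Num.sqrt (_ ^+ 2)]sqrtr_sqr ger0_norm ?sqrtr_ge0 // log2Xn //.
  move: (Num.sqrt _) s0 => s s0 h.
  have : log2 ((m2 n)%:R * s) <= log2 (2 * 3 ^+ n).
    by apply: log2_le; [exact: mulr_gt0 | have := mulr_gt0 m2R s0; nra].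
  by rewrite !log2M // ?exprn_gt0 // log2Xn // log2_2; lra.
under eq_fun do rewrite mulrDl -mulrA.
by apply: cvgD => //; apply: cvgMl_tmp.
Unshelve. all: by end_near. Qed.

End Rates.

(** * Random codes for the erasure channel *)

Lemma exists_le_average (R : realType) (T : finType) (t0 : T) (F : T -> R) B :
  \sum_t F t <= #|T|%:R * B -> exists t, F t <= B.
Proof.
move=> h; have [/existsP //|] := boolP [exists t, F t <= B].
rewrite negb_exists => /forallP nex.
suff : #|T|%:R * B < \sum_t F t by rewrite ltNge h.
rewrite mulr_natl -sumr_const; apply: ltr_sum => [|t _].
  by apply/hasP; exists t0; rewrite ?mem_index_enum.
by rewrite ltNge.
Qed.

(** The number of uses with G = 1, those not erased for Rx-2. *)
Definition weight n (b : {ffun 'I_n -> bool}) : nat := \sum_i b i.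

Section Chebyshev.
Variables (R : realType) (n : nat).

Let sg (b : bool) : R := if b then 1 else -1.

(** Flipping the bit at [i] negates the sum. *)
Let sum_sg_cross i j : i != j ->
  \sum_(b : {ffun 'I_n -> bool}) sg (b i) * sg (b j) = 0.
Proof.
move=> ij; pose f (b : {ffun 'I_n -> bool}) : {ffun 'I_n -> bool} :=
  [ffun k => if k == i then ~~ b k else b k].
have fK : involutive f.
  by move=> b; apply/ffunP => k; rewrite !ffunE; case: eqP => // _; rewrite negbK.
suff : \sum_(b : {ffun 'I_n -> bool}) sg (b i) * sg (b j)
     = - \sum_(b : {ffun 'I_n -> bool}) sg (b i) * sg (b j) by lra.
rewrite {1}(reindex_inj (inv_inj fK)) /= -sumrN; apply: eq_bigr => b _.
rewrite !ffunE eqxx [j == i]eq_sym (negPf ij) -mulNr.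
by case: (b i); rewrite /sg /= ?opprK.
Qed.

Lemma weight_variance :
  2^-1 ^+ n * \sum_(b : {ffun 'I_n -> bool}) (2 * (weight b)%:R - n%:R) ^+ 2
  = n%:R :> R.
Proof.
have wE (b : {ffun 'I_n -> bool}) :
    2 * (weight b)%:R - n%:R = \sum_i sg (b i).
  have -> : n%:R = \sum_(i < n) 1 :> R by rewrite sumr_const card_ord.
  rewrite natr_sum mulr_sumr -sumrB.
  by apply: eq_bigr => i _; case: (b i) => /=; rewrite /sg; lra.
under eq_bigr do rewrite wE expr2 mulr_suml.
under eq_bigr do under eq_bigr do rewrite mulr_sumr.
rewrite exchange_big; under eq_bigr do rewrite exchange_big.
have inner i : \sum_j \sum_(b : {ffun 'I_n -> bool}) sg (b i) * sg (b j)
    = \sum_(b : {ffun 'I_n -> bool}) 1.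
  rewrite (bigD1 i) //= [X in _ + X]big1 ?addr0; last first.
    by move=> j ji; rewrite sum_sg_cross // eq_sym.
  by apply: eq_bigr => b _; case: (b i); rewrite /sg ?mulrNN mulr1.
under eq_bigr do rewrite inner.
by rewrite sumr_const card_ord mulrnAr mean_bool.
Qed.

(** Chebyshev: a weight below [s] puts [2 * weight b] at least [2 * q] below [n]. *)
Lemma weight_lower_tail s q : (0 < q)%N -> (2 * (s + q) <= n)%N ->
  2^-1 ^+ n * \sum_(b : {ffun 'I_n -> bool}) (weight b < s)%:R
  <= n%:R / (4 * q%:R ^+ 2) :> R.
Proof.
move=> q0 sqn; have qR : 0 < q%:R :> R by rewrite ltr0n.
have den0 : 0 < 4 * q%:R ^+ 2 :> R by rewrite mulr_gt0 // exprn_gt0.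
rewrite ler_pdivlMr // -[leRHS]weight_variance -mulrA mulr_suml.
apply: ler_wpM2l; first by rewrite exprn_ge0 // invr_ge0 ler0n.
apply: ler_sum => b _; case: ltnP => [ws|_]; last by rewrite mul0r sqr_ge0.
rewrite mul1r.
have : (2 * weight b + 2 * q <= n)%N by lia.
rewrite -(ler_nat R) natrD !natrM => h.
have : 0 <= 2 * q%:R :> R by lra.
nra.
Qed.

End Chebyshev.

(** * Random codebooks and their decoding *)

Section RandomCode.
Variables (R : realType) (n m : nat).
Hypothesis m_gt0 : (0 < m)%N.

(* Codebooks are indexed by the channel use first, so that a uniformly random
   codebook is a product over the n uses. *)
Local Notation codebook := {ffun 'I_n -> {ffun 'I_m -> F3}}.

Definition agree (C : codebook) (b : {ffun 'I_n -> bool}) (d d' : 'I_m) :=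
  [forall i, b i ==> (C i d == C i d')].

(** Translating the entry at [d] shows that the three values of [c d - c d'] are equally
    frequent. *)
Lemma sum_column_eq (d d' : 'I_m) : d != d' ->
  \sum_(c : {ffun 'I_m -> F3}) (c d == c d')%:R = (3 ^ m)%:R / 3 :> R.
Proof.
move=> dd'.
have -> : (3 ^ m)%:R = \sum_(u : F3) \sum_(c : {ffun 'I_m -> F3})
    (c d == c d' + u)%:R :> R.
  rewrite exchange_big /= (eq_bigr (fun _ => 1)) => [|c _].
    by rewrite sumr_const card_ffun !card_ord.
  rewrite -[RHS](@sum_indicator1 R _ true (c d - c d')); apply: eq_bigr => u _.
  by rewrite andTb [u == _]eq_sym subr_eq addrC [u + _]addrC.
rewrite [X in _ = X / 3](eq_bigr (fun _ => \sum_(c : {ffun 'I_m -> F3}) (c d == c d')%:R)).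
  by rewrite sumr_const card_ord -[_ *+ _]mulr_natr mulfK // pnatr_eq0.
move=> u _; pose f v (c : {ffun 'I_m -> F3}) : {ffun 'I_m -> F3} :=
  [ffun k => if k == d then c k + v else c k].
have fK : cancel (f (- u)) (f u).
  by move=> c; apply/ffunP => k; rewrite !ffunE; case: eqP => //; rewrite subrK.
have fK' : cancel (f u) (f (- u)).
  by move=> c; apply/ffunP => k; rewrite !ffunE; case: eqP => //; rewrite addrK.
rewrite (reindex (f u)); last by exists (f (- u)) => c _.
apply: eq_bigr => c _; rewrite !ffunE eqxx [d' == d]eq_sym (negPf dd').
by rewrite (inj_eq (addIr u)).
Qed.

Lemma sum_agree b d d' : d != d' ->
  \sum_(C : codebook) (agree C b d d')%:R = #|{: codebook}|%:R / 3 ^+ weight b :> R.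
Proof.
move=> dd'; under eq_bigr do rewrite /agree -prod_indicator.
rewrite -(bigA_distr_bigA (fun i (c : {ffun 'I_m -> F3}) => (b i ==> (c d == c d'))%:R)) /=.
rewrite (eq_bigr (fun i => (3 ^ m)%:R * 3^-1 ^+ b i)) => [|i _].
  rewrite big_split /= prodr_const card_ord prodrXr exprVn; congr (_ / _).
  by rewrite !card_ffun !card_ord [RHS]natrX.
case: (b i) => /=; first by rewrite sum_column_eq.
by rewrite mulr1 sumr_const card_ffun !card_ord.
Qed.

Definition ambiguous (C : codebook) b d := [exists d', (d' != d) && agree C b d d'].

(** Average over all codebooks. For weight below [s], ambiguity is bounded by 1; otherwise a union
    bound over the fewer than [m] rivals, each agreeing with probability at most [3 ^- s]. *)
Lemma exists_good_codebook s : exists C : codebook,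
  \sum_b \sum_d (ambiguous C b d)%:R
  <= \sum_(b : {ffun 'I_n -> bool}) m%:R * ((weight b < s)%:R + m%:R / 3 ^+ s) :> R.
Proof.
apply: (@exists_le_average _ _ (finfun (fun _ => finfun (fun _ => 0)))
  (fun C : codebook => \sum_b \sum_d (ambiguous C b d)%:R)).
rewrite exchange_big mulr_sumr; apply: ler_sum => b _ /=.
rewrite exchange_big mulrCA /=.
have sum_m (t : R) : m%:R * t = \sum_(d < m) t.
  by rewrite sumr_const card_ord mulr_natl.
rewrite sum_m; apply: ler_sum => d _.
have m3_ge0 k : 0 <= m%:R / 3 ^+ k :> R by rewrite divr_ge0 // exprn_ge0.
case: ltnP => [ws|sw].
  apply: (@le_trans _ _ (#|{: codebook}|%:R * 1)); last by rewrite ler_wpM2l ?lerDl.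
  rewrite mulr1 -sumr_const; apply: ler_sum => C _.
  by case: ambiguous.
rewrite add0r; apply: (@le_trans _ _ (\sum_(C : codebook)
    \sum_(d' | d' != d) (agree C b d d')%:R)).
  apply: ler_sum => C _; case: (boolP (ambiguous C b d)) => [|_]; last first.
    exact: sumr_ge0.
  by move=> /existsP[d' /andP[dd' Cd']]; rewrite (bigD1 d') //= Cd' lerDl sumr_ge0.
rewrite exchange_big /= (eq_bigr (fun _ => #|{: codebook}|%:R / 3 ^+ weight b)).
  rewrite sumr_const -[leLHS]mulr_natr mulrAC -mulrA; apply: ler_wpM2l => //.
  apply: ler_pM => //.
    by rewrite ler_nat -[leqRHS]card_ord max_card.
  by rewrite lef_pV2 ?posrE ?exprn_gt0 // ler_weXn2l // ler1n.
by move=> d' dd'; rewrite sum_agree // eq_sym.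
Qed.

Variable C : codebook.

Definition encode (w : 'I_(3 ^ n) * 'I_m) : {ffun 'I_n -> F3 * F3} :=
  [ffun i => (word w.1 i, C i w.2 - word w.1 i)].

(** The default is never reached on a channel output for an encoded message, since the sent codeword
    always matches. *)
Definition decode (y2 : {ffun 'I_n -> F3 * F3}) : 'I_m :=
  odflt (Ordinal m_gt0)
    [pick d | [forall i, ((y2 i).2 == 1) ==> (C i d == (y2 i).1)]].

Lemma decode_encode w b : ~~ ambiguous C b w.2 -> decode (rx2 (encode w) b) = w.2.
Proof.
move=> namb; rewrite /decode; case: pickP => [d /forallP hd|/(_ w.2)/negbT/forallP[] i].
  apply/eqP/negPn/negP => dw; case/existsP: namb; exists d; rewrite dw.
  apply/forallP => i; have := hd i; rewrite !ffunE /=; case: (b i) => //=.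
  by rewrite mul1r addrC subrK eq_sym.
by rewrite !ffunE /=; case: (b i) => //=; rewrite mul1r addrC subrK eqxx.
Qed.

Definition det_kernel (S T : finType) (f : S -> T) : S -> T -> R :=
  fun s t => (t == f s)%:R.

Lemma det_kernelP (S T : finType) (f : S -> T) : is_cpmf (det_kernel f).
Proof. by split=> [s t|s]; [exact: ler0n|apply: (@sum_indicator1 R _ true)]. Qed.

Lemma sum_det_kernel (S T : finType) (f : S -> T) s (F : T -> R) :
  \sum_t det_kernel f s t * F t = F (f s).
Proof.
rewrite (bigD1 (f s)) //= /det_kernel eqxx mul1r big1 ?addr0 // => t /negPf->.
by rewrite mul0r.
Qed.

Lemma codebook_scheme : exists2 e2,
  classical_scheme (@ex_chan R) n (3 ^ n) m 0 e2 &
  e2 <= m%:R^-1 * (2^-1 ^+ n * \sum_b \sum_d (ambiguous C b d)%:R).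
Proof.
pose E := det_kernel encode; pose D1 := det_kernel (@word_index n).
pose D2 := det_kernel decode.
have [hE hD1 hD2] : [/\ is_cpmf E, is_cpmf D1 & is_cpmf D2].
  by split; apply: det_kernelP.
exists (err2 (classical_law (@ex_chan R) E D1 D2)).
  exists E, D1, D2; split=> //; rewrite classical_lawE err1E //; last first.
  - exact: product_box_ns.
  - by rewrite expn_gt0.
  rewrite succ1_product // mean_bool (eq_bigr (fun _ => 1)) => [|w _].
    rewrite sumr_const card_prod !card_ord mulVf ?subrr // pnatr_eq0.
    by rewrite -lt0n muln_gt0 expn_gt0.
  rewrite sum_det_kernel /D1 /det_kernel.
  have -> : in1 (encode w) = word w.1 by apply/ffunP => i; rewrite !ffunE.
  by rewrite wordK eqxx.
have n3_gt0 : (0 < 3 ^ n)%N by rewrite expn_gt0.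
rewrite classical_lawE err2E //; last exact: product_box_ns.
rewrite succ2_product //.
set S := (X in _ - _ * X); set B := (X in _ <= _ * X).
have c_gt0 : 0 < (3 ^ n * m)%:R :> R by rewrite ltr0n muln_gt0 n3_gt0.
(* Ambiguity ignores the first message, so summing over it contributes just the factor 3^n. *)
have -> : m%:R^-1 * B = (3 ^ n * m)%:R^-1 * ((3 ^ n)%:R * B).
  by rewrite natrM; field; rewrite !pnatr_eq0 -!lt0n m_gt0 n3_gt0.
have BE : (3 ^ n)%:R * B = 2^-1 ^+ n *
    \sum_b \sum_(w : 'I_(3 ^ n) * 'I_m) (ambiguous C b w.2)%:R.
  rewrite mulrCA mulr_sumr; congr (_ * _); apply: eq_bigr => b _.
  rewrite -(pair_big xpredT xpredT (fun _ d => (ambiguous C b d)%:R)) /=.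
  by rewrite sumr_const card_ord mulr_natl.
suff h : (3 ^ n * m)%:R <= S + (3 ^ n)%:R * B.
  rewrite lerBlDr -mulrDr -[leLHS](mulVf (negbT (gt_eqF c_gt0))) ler_wpM2l //.
  by rewrite addrC.
rewrite BE /S -mulrDr -[leLHS](@mean_bool R n); apply: ler_wpM2l.
  by rewrite exprn_ge0 // invr_ge0 ler0n.
rewrite -big_split; apply: ler_sum => b _ /=; rewrite -big_split /=.
have -> : (3 ^ n * m)%:R = \sum_(w : 'I_(3 ^ n) * 'I_m) 1 :> R.
  by rewrite sumr_const card_prod !card_ord.
apply: ler_sum => w _; rewrite sum_det_kernel.
have [amb|namb] := boolP (ambiguous C b w.2).
  by rewrite lerDr ler0n.
by rewrite /D2 /det_kernel decode_encode // eqxx lerDl.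
Qed.

End RandomCode.

(** * Achievability *)

(** The scheme exists for every [n], as [achievable] demands; only the error bound is conditional,
    since [q] will vanish for small [n]. *)
Lemma erasure_scheme (R : realType) n m s q : (0 < m)%N ->
  exists e2 : R, classical_scheme (@ex_chan R) n (3 ^ n) m 0 e2 /\
    ((0 < q)%N -> (2 * (s + q) <= n)%N ->
     e2 <= n%:R / (4 * q%:R ^+ 2) + m%:R / 3 ^+ s).
Proof.
move=> m_gt0; have [C hC] := exists_good_codebook R n m s.
have [e2 sch he2] := codebook_scheme R m_gt0 C; exists e2; split=> // q0 sqn.
apply: le_trans he2 _; rewrite mulrCA.
apply: (@le_trans _ _ (2^-1 ^+ n *
    \sum_(b : {ffun 'I_n -> bool}) ((weight b < s)%:R + m%:R / 3 ^+ s))).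
  apply: ler_wpM2l; first by rewrite exprn_ge0 // invr_ge0 ler0n.
  rewrite -mulr_sumr in hC.
  by rewrite mulrC ler_pdivrMr ?ltr0n // mulrC.
by rewrite big_split mulrDr mean_bool lerD2r weight_lower_tail.
Qed.

Section Achievability.
Variable R : realType.
Local Open Scope classical_set_scope.

Let L : R := log2 3.

Lemma log2_pow3 k : log2 (3 ^ k)%:R = k%:R * L.
Proof. by rewrite natrX log2Xn. Qed.

Lemma cvg_rate_pow3 : (fun n => log2 (3 ^ n)%:R / n%:R) @ \oo --> L.
Proof.
apply: (cvg_trans _ (@cvg_cst _ L _ (\oo : set_system nat) _)).
apply: near_eq_cvg; near=> n.
have n0 : 0 < n%:R :> R by rewrite ltr0n; near: n; exact: nbhs_infty_gt.
by rewrite log2_pow3 mulrAC divff ?mul1r ?gt_eqF.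
Unshelve. all: by end_near. Qed.

Lemma cvg_divn_ratio d : (0 < d)%N ->
  (fun n => (n %/ d)%:R / n%:R) @ \oo --> (d%:R^-1 : R).
Proof.
move=> d0; have dR : 0 < d%:R :> R by rewrite ltr0n.
have low : (fun n => d%:R^-1 - 1 / n%:R) @ \oo --> (d%:R^-1 : R).
  rewrite -[X in _ --> X]subr0; apply: cvgB; [exact: cvg_cst|exact: cvg_divn].
apply: squeeze_cvgr low (cvg_cst _); near=> n.
have n0 : 0 < n%:R :> R by rewrite ltr0n; near: n; exact: nbhs_infty_gt.
have h1 : (n %/ d)%:R * d%:R <= n%:R :> R by rewrite -natrM ler_nat leq_divM.
have h2 : n%:R <= ((n %/ d)%:R + 1) * d%:R :> R.
  by rewrite natr1 -natrM ler_nat ltnW // ltn_ceil.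
apply/andP; split; last by rewrite ler_pdivrMr // mulrC ler_pdivlMr.
rewrite ler_pdivlMr // mulrBl mul1r mulVf ?gt_eqF // lerBlDr.
by rewrite mulrC ler_pdivrMr.
Unshelve. all: by end_near. Qed.

Lemma NS_achievable :
  achievable (fun n m1 m2 e1 e2 => ns_scheme (@ex_chan R) n m1 m2 e1 e2) (L, L).
Proof.
exists (fun n => 3 ^ n)%N, (fun n => 3 ^ n)%N, (fun=> 0), (fun=> 0); split.
- by move=> n; rewrite expn_gt0.
- by move=> n; exact: perfect_box_scheme.
- by rewrite maxxx; exact: cvg_cst.
- by exists L; split=> //; exact: cvg_rate_pow3.
- by exists L; split=> //; exact: cvg_rate_pow3.
Qed.

(** With [q = n %/ (2 * k)], take [s = q * (k - 1)], so that [2 * (s + q) <= n], and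
    [m = 3 ^ (q * (k - 2))], so that [m / 3 ^ s = 3 ^- q]. The second rate is then (k - 2) / (2 k)
    times [L]. *)
Lemma classical_achievable k : (1 < k)%N ->
  achievable (fun n m1 m2 e1 e2 => classical_scheme (@ex_chan R) n m1 m2 e1 e2)
    (L, (2^-1 - 1 / k%:R) * L).
Proof.
move=> k1; pose q n := (n %/ (2 * k))%N.
have m_gt0 n : (0 < 3 ^ (q n * (k - 2)))%N by rewrite expn_gt0.
have /choice[e2 he2] n :=
  erasure_scheme R n (q n * (k - 1)) (q n) (m_gt0 n).
have k0 : (0 < 2 * k)%N by lia.
have kR : 0 < k%:R :> R by rewrite ltr0n; lia.
exists (fun n => 3 ^ n)%N, (fun n => 3 ^ (q n * (k - 2)))%N, (fun=> 0), e2; split.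
- by move=> n; rewrite m_gt0 expn_gt0.
- by move=> n; have [] := he2 n.
- apply: (squeeze_cvgr _ (cvg_cst 0) (cvg_divn (4 * k%:R ^+ 2 + 4 * k%:R))).
  near=> n; apply/andP; split; first by rewrite le_max lexx.
  have n2k : (2 * k <= n)%N by near: n; exact: nbhs_infty_ge.
  have q0 : (0 < q n)%N by rewrite divn_gt0.
  have qn : (q n * (2 * k) <= n)%N by exact: leq_divM.
  have nq : (n < (q n).+1 * (2 * k))%N by exact: ltn_ceil.
  have nR : 0 < n%:R :> R by rewrite ltr0n; lia.
  have qR : 0 < (q n)%:R :> R by rewrite ltr0n.
  rewrite ge_max; apply/andP; split.
    by rewrite divr_ge0 ?addr_ge0 ?mulr_ge0 ?exprn_ge0 // ltW.
  apply: le_trans ((he2 n).2 q0 _) _; first by nia.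
  (* Hence [n / (4 q^2) <= k / q <= 4 k^2 / n], and [3 ^- q <= 1 / q <= 4 k / n]: the two parts of
     the squeezing constant. *)
  have nq' : n%:R <= 4 * k%:R * (q n)%:R :> R.
    by rewrite -!natrM ler_nat; nia.
  have qinv : (q n)%:R^-1 <= 4 * k%:R / n%:R :> R.
    by rewrite ler_pdivlMr // mulrC ler_pdivrMr.
  rewrite [leRHS]mulrDl; apply: lerD.
    apply: (@le_trans _ _ (k%:R * (q n)%:R^-1)).
      rewrite ler_pdivrMr ?mulr_gt0 ?exprn_gt0 //.
      rewrite (_ : k%:R * _ * _ = 4 * k%:R * (q n)%:R) //.
      by field; rewrite gt_eqF.
    apply: le_trans (ler_wpM2l (ltW kR) qinv) _.
    by rewrite le_eqVlt; apply/predU1P; left; field; rewrite gt_eqF.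
  apply: le_trans qinv.
  have -> : (q n * (k - 1) = q n * (k - 2) + q n)%N by nia.
  rewrite exprD natrX invfM mulrA divff ?mul1r ?expf_neq0 ?pnatr_eq0 //.
  rewrite lef_pV2 ?posrE ?exprn_gt0 // -natrX ler_nat ltnW // ltn_expl //.
- by exists L; split=> //; exact: cvg_rate_pow3.
- exists ((2^-1 - 1 / k%:R) * L); split=> //=.
  have -> : (2^-1 - 1 / k%:R) * L = (2 * k)%:R^-1 * ((k - 2)%:R * L).
    rewrite natrB // natrM; field; rewrite gt_eqF //.
  under eq_fun do rewrite log2_pow3 natrM -[_ * _ * L]mulrA mulrAC.
  by apply: cvgMr_tmp; exact: cvg_divn_ratio.
Unshelve. all: by end_near. Qed.

(** The corner is reached as [k] grows, through the closure in [capacity_region]. *)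
Lemma classical_corner :
  capacity_region
    (fun n m1 m2 e1 e2 => classical_scheme (@ex_chan R) n m1 m2 e1 e2)
    (L, 2^-1 * L).
Proof.
pose u k : R * R := (L, (2^-1 - 1 / k%:R) * L).
have uP : \forall k \near \oo, capacity_region (fun n m1 m2 e1 e2 =>
    classical_scheme (@ex_chan R) n m1 m2 e1 e2) (u k).
  near=> k; apply: subset_closure; apply: classical_achievable.
  by near: k; exact: nbhs_infty_gt.
apply: (closed_cvg _ (@closed_closure _ _) uP).
have u2 : (fun k => (2^-1 - 1 / k%:R) * L) @ \oo --> 2^-1 * L.
  apply: cvgMr_tmp; rewrite -[X in _ --> X]subr0.
  by apply: cvgB; [exact: cvg_cst | exact: cvg_divn].
exact: (cvg_pair (cvg_cst L) u2).
Unshelve. all: by end_near. Qed.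

End Achievability.

Theorem theorem4 (R : realType) :
  [/\ is_cpmf (@ex_chan R),
      semi_deterministic (@ex_chan R),
      sum_capacity_NS (@ex_chan R) (2 * log2 (3 : R)) &
      sum_capacity_classical (@ex_chan R) (3 / 2 * log2 (3 : R))].
Proof.
split.
- exact: ex_chan_cpmf.
- exact: ex_chan_semi_deterministic.
- split; last first.
    by apply: capacity_region_le => r /NS_rate_le[]; lra.
  exists (log2 3, log2 3) => /=; last by lra.
  by apply: subset_closure; exact: NS_achievable.
- split; last by apply: capacity_region_le => r /classical_rate_le.
  exists (log2 3, 2^-1 * log2 3) => /=; last by lra.
  exact: classical_corner.
Qed.
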